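(* Let $\mathcal{G}=(\mathcal{V},\mathcal{E})$ be a finite directed graph with positive edge weights and source set $S$, satisfying Assumption A1, and let $D(\cdot)$ be generated by the asynchronous adaptive Bellman--Ford algorithm from an arbitrary initial state $D(0)$, with event sequences and execution queues satisfying Assumption A2. Let $$T_P^+=P\,\mathcal{D}(\mathcal{G}),\qquad T_P^-=P\left\lceil\frac{d^*_{\max}-D^{\min}(0)}{e_{\min}}\right\rceil,\qquad T_P=\begin{cases}\max(T_P^+,T_P^-) & \text{if }\mathcal{S}^-(0)\ne\varnothing,\\ T_P^+ & \text{if }\mathcal{S}^-(0)=\varnothing.\end{cases}$$ Then for all $t\ge T_P$: $\Delta^+(t)=\Delta^-(t)=L(t)=L_+(t)=0$.
   Context: Graph and distances. $\mathcal{G}=(\mathcal{V},\mathcal{E})$ is a finite directed graph with weights $e_{ij}>0$ for $(i,j)\in\mathcal{E}$, and $e_{\min}=\min_{(i,j)\in\mathcal{E}}e_{ij}$; $S\subset\mathcal{V}$ (proper subset) is the source set; $\mathcal{N}(i)=\{j:(i,j)\in\mathcal{E}\}$. Assumption A1: from each $i\in\mathcal{V}$ there is a directed path to $S$. $d_i^*$ is the minimum of $\sum_{(v,v')\in\mathcal{P}}e_{vv'}$ over directed paths $\mathcal{P}$ from $i$ to a vertex of $S$ ($d_i^*=0$ for $i\in S$), and $d^*_{\max}=\max_{i\in\mathcal{V}}d_i^*$. The effective diameter $\mathcal{D}(\mathcal{G})$ is the maximum number of nodes in any shortest path (path attaining $d_i^*$) from any vertex $i\in\mathcal{V}$ to $S$.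 Algorithm. The state at time $t\in\{0,1,2,\dots\}$ is $D(t)=[\{d_i(t)\}_{i\in\mathcal{V}},\{m_{ij}(t)\}_{(i,j)\in\mathcal{E}},\{d_{ij}(t)\}_{(i,j)\in\mathcal{E}}]$, with entries in $\mathbb{R}\cup\{+\infty\}$. The possible actions are: Read$(i,j)$: $d_{ij}\leftarrow m_{ij}$; Update$(i)$: $d_i\leftarrow \min_{j\in\mathcal{N}(i)}(d_{ij}+e_{ij})$ if $i\notin S$, and $d_i\leftarrow 0$ if $i\in S$; Write$(i,j)$: $m_{ij}\leftarrow d_j$. $D(0)$ is the initial state. For each $t\ge1$ there are sets $\mathcal{R}(t)\subseteq\mathcal{E}$, $\mathcal{U}(t)\subseteq\mathcal{V}$, $\mathcal{W}(t)\subseteq\mathcal{E}$ and an execution queue $\mathcal{Q}(t)$, i.e. an ordered list containing exactly once each of Read$(i,j)$ for $(i,j)\in\mathcal{R}(t)$, Update$(i)$ for $i\in\mathcal{U}(t)$, Write$(i,j)$ for $(i,j)\in\mathcal{W}(t)$, in arbitrary order. $D(t)$ is obtained from $D(t-1)$ by executing the instructions of $\mathcal{Q}(t)$ sequentially. Assumption A2: there are integers $P_R\ge0$, $P_U\ge1$, $P_W\ge0$ such that for all $t\geq 1$: $\bigcup_{k=0}^{\max(0,P_R-1)}\mathcal{R}(t+k)=\mathcal{E}$, $\bigcup_{k=0}^{P_U-1}\mathcal{U}(t+k)=\mathcal{V}$, $\bigcup_{k=0}^{\max(0,P_W-1)}\mathcal{W}(t+k)=\mathcal{E}$. Convention: $P_W=0$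 additionally means that in each queue all Writes come after all Updates and before all Reads; $P_R=0$ additionally means that in each queue all Reads come after all non-Read instructions. The asynchrony measure is $P:=P_R+P_U+P_W$. Errors. $D^*=[\{d_i^*\}_{i\in\mathcal{V}},\{d_j^*\}_{(i,j)\in\mathcal{E}},\{d_j^*\}_{(i,j)\in\mathcal{E}}]$ is the vector of true values of $D$. $\Delta^{+}(t)$ (resp. $\Delta^-(t)$) is the maximum of $0$ and of all entries of $D(t)-D^*$ (resp. $D^*-D(t)$). $L_+(t)=\Delta^+(t)+\Delta^-(t)$ and $L(t)=\max[\Delta^+(t),\Delta^-(t)]$. $\mathcal{S}^-(t)$ is the set of indices $k$ (over all node estimates and buffers) with $[D(t)]_k<D^*_k$. $D^{\min}(t)=\min_{k\in\mathcal{S}^-(t)}[D(t)]_k$, and $D^{\min}(t)=\infty$ if $\mathcal{S}^-(t)=\varnothing$. *)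

(* Defs.v *)
From HB Require Import structures.
From mathcomp Require Import all_boot all_order all_algebra.
From mathcomp Require Import reals constructive_ereal.

Set Implicit Arguments.
Unset Strict Implicit.
Unset Printing Implicit Defensive.

Import Order.TTheory GRing.Theory Num.Theory.

Local Open Scope ring_scope.
Local Open Scope ereal_scope.

Section Graph.
Context {R : realType} {V : finType}.
Variables (E : {set V * V}) (w : V -> V -> R) (S : {set V}).

Definition edge : finType := {a : V * V | a \in E}.
Definition arc_src (a : edge) : V := (val a).1.
Definition arc_dst (a : edge) : V := (val a).2.

(* The path visits [i :: p]; for [i \in S] the trivial path [p = [::]] counts. *)
Definition dipath_to (i : V) (p : seq V) : bool :=
  [&& path [rel u v | (u, v) \in E] i p, uniq (i :: p) & last i p \in S].

Fixpoint path_weight (i : V) (p : seq V) : R :=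
  if p is j :: p' then (w i j + path_weight j p')%R else 0%R.

(* A path without repeated vertices has at most #|V| nodes, so ranging over
   the finite type of sequences of length at most #|V| loses no path.  The
   value is +oo when S cannot be reached from i. *)
Definition dstar (i : V) : \bar R :=
  \big[mine/+oo]_(p : #|V|.-bseq V | dipath_to i p) (path_weight i p)%:E.

Definition reachable_source : Prop :=
  forall i : V, exists p : seq V, dipath_to i p.

Definition dstar_max : \bar R := \big[maxe/-oo]_(i : V) dstar i.

Definition e_min : \bar R := \big[mine/+oo]_(a : edge) (w (arc_src a) (arc_dst a))%:E.

Definition shortest_path (i : V) (p : seq V) : bool :=
  dipath_to i p && ((path_weight i p)%:E == dstar i).

Definition effective_diameter : nat :=
  \max_(i : V) \max_(p : #|V|.-bseq V | shortest_path i p) (size p).+1.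

Definition coord : finType := (V + edge + edge)%type.
Definition c_est (i : V) : coord := inl (inl i).   (* d_i    *)
Definition c_mem (a : edge) : coord := inl (inr a). (* m_ij   *)
Definition c_buf (a : edge) : coord := inr a.       (* d_ij   *)

Definition state : Type := coord -> \bar R.

Definition Dstar : state := fun k =>
  match k with
  | inl (inl i) => dstar i
  | inl (inr a) => dstar (arc_dst a)
  | inr a => dstar (arc_dst a)
  end.

Inductive instr : Type :=
| Read of edge
| Update of V
| Write of edge.

Definition instr_code (x : instr) : edge + V + edge :=
  match x with Read a => inl (inl a) | Update i => inl (inr i) | Write a => inr a end.
Definition instr_decode (c : edge + V + edge) : instr :=
  match c with inl (inl a) => Read a | inl (inr i) => Update i | inr a => Write a end.
Lemma instr_codeK : cancel instr_code instr_decode.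
Proof. by case. Qed.
HB.instance Definition _ := Equality.copy instr (can_type instr_codeK).

Definition is_read (x : instr) : bool := if x is Read _ then true else false.
Definition is_update (x : instr) : bool := if x is Update _ then true else false.
Definition is_write (x : instr) : bool := if x is Write _ then true else false.

Definition exec (D : state) (x : instr) : state :=
  match x with
  | Read a => [eta D with c_buf a |-> D (c_mem a)]
  | Update i => [eta D with c_est i |->
      if i \in S then 0
      else \big[mine/+oo]_(a : edge | arc_src a == i)
             (D (c_buf a) + (w (arc_src a) (arc_dst a))%:E)]
  | Write a => [eta D with c_mem a |-> D (c_est (arc_dst a))]
  end.

Fixpoint trajectory (D0 : state) (Q : nat -> seq instr) (t : nat) : state :=
  if t is t'.+1 then foldl exec (trajectory D0 Q t') (Q t) else D0.

Definition valid_queue (Rd : {set edge}) (Up : {set V}) (Wr : {set edge})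
    (q : seq instr) : Prop :=
  [/\ uniq q,
      forall a, (Read a \in q) = (a \in Rd),
      forall i, (Update i \in q) = (i \in Up) &
      forall a, (Write a \in q) = (a \in Wr)].

Definition all_before (A B : pred instr) (q : seq instr) : Prop :=
  forall x y, x \in q -> y \in q -> A x -> B y -> (index x q < index y q)%N.

(* [n - 1] is truncated, hence equal to max(0, n - 1). *)
Definition bounded_asynchrony (PR PU PW : nat)
    (Rd : nat -> {set edge}) (Up : nat -> {set V}) (Wr : nat -> {set edge})
    (Q : nat -> seq instr) : Prop :=
  [/\ (1 <= PU)%N,
      forall t : nat, (1 <= t)%N ->
        [/\ \bigcup_(k < (PR - 1).+1) Rd (t + k)%N = [set: edge],
            \bigcup_(k < PU) Up (t + k)%N = [set: V] &
            \bigcup_(k < (PW - 1).+1) Wr (t + k)%N = [set: edge]],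
      PW = 0%N -> forall t : nat, (1 <= t)%N ->
        all_before is_update is_write (Q t) /\
        all_before is_write is_read (Q t) &
      PR = 0%N -> forall t : nat, (1 <= t)%N ->
        all_before (predC is_read) is_read (Q t)].

Definition Delta_plus (D : state) : \bar R :=
  \big[maxe/0]_(k : coord) (D k - Dstar k).
Definition Delta_minus (D : state) : \bar R :=
  \big[maxe/0]_(k : coord) (Dstar k - D k).
Definition L_plus (D : state) : \bar R := Delta_plus D + Delta_minus D.
Definition L_max (D : state) : \bar R := maxe (Delta_plus D) (Delta_minus D).

Definition Sminus (D : state) : {set coord} := [set k | D k < Dstar k].
Definition D_min (D : state) : \bar R := \big[mine/+oo]_(k in Sminus D) D k.

Definition T_plus (P : nat) : int := (P * effective_diameter)%N%:Z.

(* When [Sminus D0] is nonempty and reachability holds, the arguments of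
   [fine] are finite; otherwise this value is not used. *)
Definition T_minus (P : nat) (D0 : state) : int :=
  (P%:Z * Num.ceil (fine (dstar_max - D_min D0) / fine e_min))%R.

Definition T_conv (P : nat) (D0 : state) : int :=
  if Sminus D0 != set0 then Order.max (T_plus P) (T_minus P D0) else T_plus P.

End Graph.

Arguments Read {V E}.
Arguments Update {V E}.
Arguments Write {V E}.
Arguments c_est {V E}.

(* Main.v *)
Require Import Defs.
From mathcomp Require Import all_boot all_order all_algebra.
From mathcomp Require Import reals constructive_ereal.
Import Order.TTheory GRing.Theory Num.Theory.
Local Open Scope ring_scope.

Set Implicit Arguments.
Unset Strict Implicit.
Unset Printing Implicit Defensive.

(* Call a round any P = P_R + P_U + P_W consecutive time steps.  Suppose that
   every entry of the state, whether an estimate or a buffered copy of one,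
   satisfies a property A of the node it refers to, and that updating node i
   from such entries yields a value satisfying a stronger property B of i.  Then
   P_U steps give B to all estimates, P_W further steps to all m_ij, and P_R
   further steps to all d_ij; when P_W = 0 or P_R = 0 the queue order makes the
   corresponding copy exact at the end of every step t >= 1.  So a chain
   A_0, A_1, ... of properties advances by one index per round.

   Upper bound: A_n is "d_i <= d_i* for nodes having a shortest path with at
   most n nodes".
   Lower bound: A_n is "d_i >= min (d_i*, c + n e_min)" with c = D^min(0). *)

(** * Shortest paths: attainment, triangle inequality, optimal tails *)

Section ShortestPaths.
Context {R : realType} {V : finType}.
Variables (E : {set V * V}) (w : V -> V -> R) (S : {set V}).
Hypothesis w_gt0 : forall i j, (i, j) \in E -> 0 < w i j.
Hypothesis S_reachable : reachable_source E S.

Let dist i : R := fine (dstar E w S i).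

Lemma path_weight_ge0 i p :
  path [rel u v | (u, v) \in E] i p -> 0 <= path_weight w i p.
Proof.
elim: p i => //= j p IHp i /andP[ij jp].
by rewrite addr_ge0 ?IHp // ltW ?w_gt0.
Qed.

Lemma path_weight_cat i p q :
  path_weight w i (p ++ q) = path_weight w i p + path_weight w (last i p) q.
Proof. by elim: p i => [|j p IHp] i /=; rewrite ?add0r // IHp addrA. Qed.

Lemma dipath_size i p : dipath_to E S i p -> (size p <= #|V|)%N.
Proof.
by move=> /and3P[_ /= /andP[_ up] _]; rewrite -(card_uniqP up) max_card.
Qed.

Lemma dstar_le i p :
  dipath_to E S i p -> (dstar E w S i <= (path_weight w i p)%:E)%E.
Proof.
move=> ip; have h := dipath_size ip.
exact: (@bigmin_le_cond _ _ _ _ (Bseq h)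
  (fun q => dipath_to E S i (bseqval q)) _ ip).
Qed.

(** A minimum over a finite family is attained; [S_reachable] supplies a candidate, so the default
    [+oo] is never the only value. *)
Lemma shortest_path_exists i :
  exists2 p : seq V, shortest_path E w S i p & (size p <= #|V|)%N.
Proof.
have [p ip] := S_reachable i; have h := dipath_size ip.
have [||q iq dq] := @eq_bigmin _ _ _ +oo%E (Bseq h)
  (fun q : #|V|.-bseq V => dipath_to E S i q) (fun q => (path_weight w i q)%:E).
- exact: ip.
- by move=> q _; rewrite leey.
exists q; last exact: size_bseq.
have {}iq : dipath_to E S i q := iq.
by rewrite /shortest_path iq /dstar dq eqxx.
Qed.

Lemma shortest_path_size i p :
  shortest_path E w S i p -> (size p < effective_diameter E w S)%N.
Proof.
move=> ip; have /andP[/dipath_size h _] := ip.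
apply: leq_trans (leq_bigmax i).
exact: (@leq_bigmax_cond _ (fun q : #|V|.-bseq V => shortest_path E w S i q)
  (fun q => (size q).+1) (Bseq h) ip).
Qed.

Lemma dstarE i : dstar E w S i = (dist i)%:E.
Proof.
have [p /andP[_ /eqP pE] _] := shortest_path_exists i.
by rewrite /dist -pE.
Qed.

Lemma dist_ge0 i : 0 <= dist i.
Proof.
have [p /andP[/and3P[ip _ _] /eqP pE] _] := shortest_path_exists i.
by rewrite /dist -pE path_weight_ge0.
Qed.

Lemma dist_le i p : dipath_to E S i p -> dist i <= path_weight w i p.
Proof. by move=> /dstar_le; rewrite dstarE lee_fin. Qed.

Lemma dist_shortest i p : shortest_path E w S i p -> dist i = path_weight w i p.
Proof. by case/andP => _ /eqP; rewrite dstarE => -[]. Qed.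

Lemma dist_source i : i \in S -> dist i = 0.
Proof.
move=> iS; apply: le_anti; rewrite dist_ge0 andbT.
by have := @dist_le i [::]; rewrite /dipath_to /= iS; apply.
Qed.

(** Prepending [i] to a shortest path from [j] may repeat [i]. In that case the suffix starting at
    [i] is itself a simple path to [S], and the part cut off has nonnegative weight. *)
Lemma dist_edge i j : (i, j) \in E -> dist i <= w i j + dist j.
Proof.
move=> ij; have [p jp _] := shortest_path_exists j.
have /andP[/and3P[pj up lp] _] := jp; rewrite (dist_shortest jp).
have [ip|ip] := boolP (i \in j :: p); last first.
  apply: (@dist_le i (j :: p)); move: up.
  by rewrite /dipath_to /= ij pj lp ip => ->.
case/splitPl: ip pj up lp {jp} => p1 p2 lp1.
rewrite cat_path last_cat lp1 => /andP[jp1 ip2] up lp2.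
rewrite path_weight_cat lp1 addrA ler_wpDl //.
  by rewrite addr_ge0 ?path_weight_ge0 // ltW ?w_gt0.
apply: dist_le; rewrite /dipath_to ip2 lp2 andbT /=.
(* Regrouped as [belast j p1 ++ i :: p2], the simple path has [i :: p2] as a simple suffix. *)
move: up; rewrite -cat_cons lastI cat_rcons lp1 => /=.
by rewrite cat_uniq => /and3P[].
Qed.

(** Optimal substructure: by [dist_edge], a path from [j] cheaper than [p] would make [i] cheaper as
    well. *)
Lemma shortest_path_cons i j p : shortest_path E w S i (j :: p) ->
  [/\ (i, j) \in E, shortest_path E w S j p & dist i = w i j + dist j].
Proof.
move=> ijp; have := dist_shortest ijp => /= di.
have /andP[/and3P[/= /andP[ij jp] /andP[_ up] lp] _] := ijp.
have djp : dipath_to E S j p by rewrite /dipath_to jp /= up.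
have dj : dist j = path_weight w j p.
  apply: le_anti; rewrite dist_le //=.
  by have := dist_edge ij; rewrite di lerD2l.
by split=> //; rewrite ?di ?dj // /shortest_path djp dstarE dj eqxx.
Qed.

End ShortestPaths.

(** * Invariants along queues, time steps and rounds *)

Section Dynamics.
Context {R : realType} {V : finType}.
Variables (E : {set V * V}) (w : V -> V -> R) (S : {set V}).

Local Notation state := (state (R := R) E).
Local Notation exec := (exec (E := E) w S).

(** A buffer on an edge stores a copy of the estimate of the edge's head, so Reads and Writes move
    values between coordinates of the same node. *)
Definition coord_node (k : Defs.coord E) : V :=
  match k with
  | inl (inl i) => i
  | inl (inr a) => arc_dst a
  | inr a => arc_dst a
  end.

Lemma foldl_exec_invariant (I : state -> Prop) (q : seq (instr E)) D :
  (forall D x, x \in q -> I D -> I (exec D x)) -> I D -> I (foldl exec D q).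
Proof.
elim: q D => //= x q IHq D hI ID; apply: IHq => [D' y yq|].
  by apply: hI; rewrite inE yq orbT.
by apply: hI; rewrite ?mem_head.
Qed.

(** [G] need only survive in the presence of [I]: the queue is cut at [x], [I] is carried up to it,
    [x] creates [G], and both are carried on together. *)
Lemma foldl_exec_establish (I G : state -> Prop) (q : seq (instr E)) x D :
  (forall D y, I D -> I (exec D y)) ->
  (forall D y, I D -> G D -> G (exec D y)) ->
  (forall D, I D -> G (exec D x)) ->
  x \in q -> I D -> G (foldl exec D q).
Proof.
move=> hI hG hx xq ID; case/splitPr: xq => q1 q2; rewrite foldl_cat /=.
have I1 : I (foldl exec D q1) by apply: foldl_exec_invariant => // ? ? _; apply: hI.
apply: (proj2 (@foldl_exec_invariant (fun D => I D /\ G D) _ _ _ _)) => //.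
  by move=> D' y _ [ID' GD']; split; [exact: hI|exact: hG].
by split; [exact: hI|exact: hx].
Qed.

Lemma exec_est D x i : x != Update i -> exec D x (c_est i) = D (c_est i).
Proof. by case: x => //= j ji; case: eqP => // -[ij]; rewrite ij eqxx in ji. Qed.

Lemma exec_mem D x a : x != Write a -> exec D x (c_mem a) = D (c_mem a).
Proof. by case: x => //= b ba; case: eqP => // -[ab]; rewrite ab eqxx in ba. Qed.

Lemma exec_buf D x a : x != Read a -> exec D x (c_buf a) = D (c_buf a).
Proof. by case: x => //= b ba; case: eqP => // -[ab]; rewrite ab eqxx in ba. Qed.

Lemma exec_write D a : exec D (Write a) (c_mem a) = D (c_est (arc_dst a)).
Proof. by rewrite /= eqxx. Qed.

Lemma exec_read D a : exec D (Read a) (c_buf a) = D (c_mem a).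
Proof. by rewrite /= eqxx. Qed.

Definition all_coords (A : V -> \bar R -> Prop) (D : state) : Prop :=
  forall k, A (coord_node k) (D k).

Definition update_sound (A B : V -> \bar R -> Prop) : Prop :=
  forall D i, all_coords A D -> B i (exec D (Update i) (c_est i)).

(** Only an Update computes a new value; the other instructions copy within one node. *)
Lemma all_coords_exec A D x :
  update_sound A A -> all_coords A D -> all_coords A (exec D x).
Proof.
move=> hA AD [[i|a]|a].
- have [->|xi] := eqVneq x (Update i); first exact: hA.
  by rewrite exec_est //; apply: (AD (c_est i)).
- have [->|xa] := eqVneq x (Write a).
    by rewrite exec_write; apply: (AD (c_est (arc_dst a))).
  by rewrite exec_mem //; apply: (AD (c_mem a)).
- have [->|xa] := eqVneq x (Read a).
    by rewrite exec_read; apply: (AD (c_mem a)).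
  by rewrite exec_buf //; apply: (AD (c_buf a)).
Qed.

Variables (D0 : state) (Q : nat -> seq (instr E)).
Local Notation D := (trajectory w S D0 Q).

Lemma trajectory_invariant (I : state -> Prop) t0 t :
  (forall D x, I D -> I (exec D x)) -> (t0 <= t)%N -> I (D t0) -> I (D t).
Proof.
move=> hI; elim: t => [|t IHt]; first by rewrite leqn0 => /eqP->.
rewrite leq_eqVlt => /orP[/eqP->//|/IHt h /h It].
by apply: foldl_exec_invariant => // D' x _; apply: hI.
Qed.

Lemma trajectory_establish (I G : state -> Prop) x t0 t1 t :
  (forall D y, I D -> I (exec D y)) ->
  (forall D y, I D -> G D -> G (exec D y)) ->
  (forall D, I D -> G (exec D x)) ->
  (t0 < t1 <= t)%N -> x \in Q t1 -> I (D t0) -> G (D t).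
Proof.
move=> hI hG hx /andP[lt01 let1] xq I0.
suff: (fun D => I D /\ G D) (D t1).
  move=> h; apply: (proj2 (@trajectory_invariant (fun D => I D /\ G D) t1 t _ _ _)) => //.
  by move=> D' y [ID' GD']; split; [exact: hI|exact: hG].
have It : I (D t1) by apply: (@trajectory_invariant _ t0) => //; exact: ltnW.
split=> //; case: t1 lt01 xq {let1 It} => // t1 lt01 xq.
by apply: (foldl_exec_establish hI hG hx xq); apply: (@trajectory_invariant _ t0).
Qed.


(** An [A] instruction behind [x] would have a larger index than [x]; uniqueness ensures that
    [index] finds no earlier occurrence. *)
Lemma all_before_tail (A B : pred (instr E)) q1 x q2 y :
  uniq (q1 ++ x :: q2) -> all_before A B (q1 ++ x :: q2) -> B x ->
  y \in q2 -> ~~ A y.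
Proof.
rewrite uniq_catC /= => /andP[]; rewrite mem_cat negb_or => /andP[xq2 xq1].
rewrite cat_uniq => /and3P[_ /hasPn q12 _] hAB Bx yq2.
apply/negP => Ay.
have yq1 : y \notin q1 by apply/negP => /q12 /negP.
have xy : x != y by apply: contraNneq xq2 => ->.
have := hAB y x; rewrite !mem_cat !inE yq2 eqxx !orbT => /(_ isT isT Ay Bx).
by rewrite !index_cat (negPf yq1) (negPf xq1) /= eqxx (negPf xy) addn0 ltnNge leq_addr.
Qed.

Variables (PR PU PW : nat).
Variables (Rd : nat -> {set edge E}) (Up : nat -> {set V}) (Wr : nat -> {set edge E}).
Hypothesis Q_valid :
  forall t : nat, (1 <= t)%N -> valid_queue (Rd t) (Up t) (Wr t) (Q t).
Hypothesis Q_async : bounded_asynchrony PR PU PW Rd Up Wr Q.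

(** Each step writes every edge, and no Update follows that Write in the queue, so the copy is still
    exact when the step ends. *)
Lemma mem_synced t a : PW = 0%N -> (1 <= t)%N ->
  D t (c_mem a) = D t (c_est (arc_dst a)).
Proof.
case: Q_async => _ cover orderW _ PW0 t_gt0.
have [_ _ covW] := cover t t_gt0.
have [before _] := orderW PW0 t t_gt0.
have [uq _ _ inW] := Q_valid t_gt0.
have : Write a \in Q t.
  (* The window has length [(0 - 1).+1 = 1], so [Wr t] alone covers all edges. *)
  rewrite inW; have : a \in [set: edge E] by [].
  by rewrite -covW PW0 big_ord1 addn0.
case: t {covW inW} t_gt0 uq before => // t _ uq before aQ.
rewrite /=; case/splitPr: aQ uq before => q1 q2 uq before.
rewrite foldl_cat /=.
apply: (@foldl_exec_invariant
  (fun D => D (c_mem a) = D (c_est (arc_dst a)))); last first.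
  by rewrite /= eqxx.
move=> D' x xq2 ID'.
have nx : x != Update (arc_dst a).
  by apply/eqP => ux; have := all_before_tail uq before isT xq2; rewrite ux.
rewrite exec_est //; have [->|xa] := eqVneq x (Write a); first exact: exec_write.
by rewrite exec_mem.
Qed.

(** Only Reads can follow the Read of [a] in the queue, so [c_mem a] no longer changes. *)
Lemma buf_synced t a : PR = 0%N -> (1 <= t)%N ->
  D t (c_buf a) = D t (c_mem a).
Proof.
case: Q_async => _ cover _ orderR PR0 t_gt0.
have [covR _ _] := cover t t_gt0.
have before := orderR PR0 t t_gt0.
have [uq inR _ _] := Q_valid t_gt0.
have : Read a \in Q t.
  rewrite inR; have : a \in [set: edge E] by [].
  by rewrite -covR PR0 big_ord1 addn0.
case: t {covR inR} t_gt0 uq before => // t _ uq before aQ.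
rewrite /=; case/splitPr: aQ uq before => q1 q2 uq before.
rewrite foldl_cat /=.
apply: (@foldl_exec_invariant (fun D => D (c_buf a) = D (c_mem a))); last first.
  by rewrite /= eqxx.
move=> D' x xq2 ID'.
have nx : x != Write a.
  by apply/eqP => ux; have := all_before_tail uq before isT xq2; rewrite ux.
rewrite exec_mem //; have [->|xa] := eqVneq x (Read a); first exact: exec_read.
by rewrite exec_buf.
Qed.

Lemma all_coords_round (A B : V -> \bar R -> Prop) t0 t :
  (forall i v, B i v -> A i v) -> update_sound A B ->
  (t0 + (PR + PU + PW) <= t)%N ->
  all_coords A (D t0) -> all_coords B (D t).
Proof.
move=> BA hAB le_t A0; have [PU_gt0 cover _ _] := Q_async.
have hAA : update_sound A A by move=> D' i AD'; apply/BA/hAB.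
have hA D' x : all_coords A D' -> all_coords A (exec D' x).
  exact: all_coords_exec.
have At s : (t0 <= s)%N -> all_coords A (D s).
  by move=> h; apply: (trajectory_invariant hA h).
have Best s : (t0 + PU <= s)%N -> forall i, B i (D s (c_est i)).
  move=> le_s i; have [_ covU _] := cover t0.+1 isT.
  have : i \in [set: V] by [].
  rewrite -covU => /bigcupP[k _ ik].
  have [_ _ inU _] := @Q_valid (t0.+1 + k) isT.
  apply: (@trajectory_establish _ (fun D => B i (D (c_est i))) (Update i)
    t0 (t0.+1 + k) s hA _ _ _ _ A0).
  - move=> D' x AD' BD'; have [->|xi] := eqVneq x (Update i); first exact: hAB.
    by rewrite exec_est.
  - by move=> D' AD'; exact: hAB.
  - rewrite addSn ltnS leq_addr /=; apply: leq_trans le_s.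
    by rewrite -addnS leq_add2l.
  - by rewrite inU.
(* [A] stays in the invariant because later Updates may recompute an estimate and must yield [B]
   again. *)
pose I1 D' := all_coords A D' /\ forall i, B i (D' (c_est i)).
have hI1 D' x : I1 D' -> I1 (exec D' x).
  move=> [AD' BD']; split; first exact: hA.
  move=> i; have [->|xi] := eqVneq x (Update i); first exact: hAB.
  by rewrite exec_est.
have Bmem s : (t0 + PU + PW <= s)%N -> forall a, B (arc_dst a) (D s (c_mem a)).
  move=> le_s a.
  have [PW0|PW_gt0] := posnP PW.
    (* [PU] is at least 1, which puts [s] past the arbitrary initial state. *)
    rewrite mem_synced //; last first.
      by apply: leq_trans le_s; rewrite -addnA addn_gt0 addn_gt0 PU_gt0 orbT.
    by apply: Best; apply: leq_trans le_s; rewrite leq_addr.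
  have [_ _ covW] := cover (t0 + PU).+1 isT.
  have : a \in [set: edge E] by [].
  rewrite -covW => /bigcupP[k _ ak].
  have [_ _ _ inW] := @Q_valid ((t0 + PU).+1 + k) isT.
  apply: (@trajectory_establish I1 (fun D => B (arc_dst a) (D (c_mem a)))
    (Write a) (t0 + PU) ((t0 + PU).+1 + k) s hI1).
  - move=> D' x [_ BD'] BmD'; have [->|xa] := eqVneq x (Write a).
      by rewrite exec_write.
    by rewrite exec_mem.
  - by move=> D' [_ BD']; rewrite exec_write.
  - rewrite addSn ltnS leq_addr /=; apply: leq_trans le_s.
    rewrite -addnS leq_add2l; apply: leq_trans (ltn_ord k) _.
    by rewrite subn1 prednK.
  - by rewrite inW.
  - by split; [apply: At; rewrite leq_addr|exact: Best].
pose I2 D' := I1 D' /\ forall a, B (arc_dst a) (D' (c_mem a)).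
have hI2 D' x : I2 D' -> I2 (exec D' x).
  move=> [ID' BD']; split; first exact: hI1.
  move=> a; have [->|xa] := eqVneq x (Write a).
    by rewrite exec_write; case: ID'.
  by rewrite exec_mem.
have le_t' : (t0 + PU + PW + PR <= t)%N.
  by apply: leq_trans le_t; rewrite -!addnA leq_add2l [leqRHS]addnC !addnA.
have Bbuf a : B (arc_dst a) (D t (c_buf a)).
  have [PR0|PR_gt0] := posnP PR.
    rewrite buf_synced //; last first.
      by apply: leq_trans le_t'; rewrite !addn_gt0 PU_gt0 orbT.
    by apply: Bmem; apply: leq_trans le_t'; rewrite leq_addr.
  have [covR _ _] := cover (t0 + PU + PW).+1 isT.
  have : a \in [set: edge E] by [].
  rewrite -covR => /bigcupP[k _ ak].
  have [_ inR _ _] := @Q_valid ((t0 + PU + PW).+1 + k) isT.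
  apply: (@trajectory_establish I2 (fun D => B (arc_dst a) (D (c_buf a)))
    (Read a) (t0 + PU + PW) ((t0 + PU + PW).+1 + k) t hI2).
  - move=> D' x [_ BD'] BbD'; have [->|xa] := eqVneq x (Read a).
      by rewrite exec_read.
    by rewrite exec_buf.
  - by move=> D' [_ BD']; rewrite exec_read.
  - rewrite addSn ltnS leq_addr /=; apply: leq_trans le_t'.
    rewrite -addnS leq_add2l; apply: leq_trans (ltn_ord k) _.
    by rewrite subn1 prednK.
  - by rewrite inR.
  - split; last exact: Bmem.
    by split; [apply: At; rewrite -addnA leq_addr|apply: Best; rewrite leq_addr].
case=> [[i|a]|a]; last exact: Bbuf.
  by apply: (Best t); apply: leq_trans le_t'; rewrite -addnA leq_addr.
by apply: (Bmem t); apply: leq_trans le_t'; rewrite leq_addr.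
Qed.

Lemma all_coords_rounds (A : nat -> V -> \bar R -> Prop) n t :
  (forall m i v, A m.+1 i v -> A m i v) ->
  (forall m, update_sound (A m) (A m.+1)) ->
  ((PR + PU + PW) * n <= t)%N ->
  all_coords (A 0%N) D0 -> all_coords (A n) (D t).
Proof.
move=> AS hA; elim: n t => [|n IHn] t le_t A0.
  apply: (@trajectory_invariant (all_coords (A 0%N)) 0 t) => // D' x.
  by apply: all_coords_exec => D'' i h; apply/AS/hA.
apply: (@all_coords_round (A n) (A n.+1) ((PR + PU + PW) * n)) => //.
- exact: AS.
- by rewrite addnC -mulnS.
- exact: IHn.
Qed.

End Dynamics.

(** * Correction of overestimates and of underestimates *)

Section Convergence.
Context {R : realType} {V : finType}.
Variables (E : {set V * V}) (w : V -> V -> R) (S : {set V}).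
Hypothesis w_gt0 : forall i j, (i, j) \in E -> 0 < w i j.
Hypothesis S_reachable : reachable_source E S.

Let dist i : R := fine (dstar E w S i).
Let distE : forall i, dstar E w S i = (dist i)%:E := dstarE w S_reachable.

Lemma exec_update (D : state (R := R) E) i :
  exec w S D (Update i) (c_est i) =
  (if i \in S then 0 else \big[mine/+oo]_(a : edge E | arc_src a == i)
     (D (c_buf a) + (w (arc_src a) (arc_dst a))%:E))%E.
Proof. by rewrite /= eqxx. Qed.

(* A node whose shortest path has n + 1 nodes is corrected one round after its
   successor on that path. *)
Definition upper_bounded n i (v : \bar R) : Prop :=
  forall p : seq V, shortest_path E w S i p -> (size p < n)%N ->
    (v <= dstar E w S i)%E.

(** The next node on a shortest path has a shortest path with one node fewer, so its buffered value
    is already bounded, and the minimum is at most the term of that edge. *)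
Lemma upper_bounded_update n :
  update_sound E w S (upper_bounded n) (upper_bounded n.+1).
Proof.
move=> D i AD p ip lt_p; rewrite exec_update; case: ifPn => iS.
  by rewrite distE lee_fin dist_ge0.
case: p ip lt_p => [|j p] ip lt_p.
  by case/andP: ip => /and3P[_ _ /= iS']; rewrite iS' in iS.
have [ij jp di] := shortest_path_cons w_gt0 S_reachable ip.
pose a : edge E := exist _ (i, j) ij.
apply: (@bigmin_inf _ _ _ _ a); first exact: eqxx.
have /(_ p jp lt_p) := AD (c_buf a).
rewrite /= /arc_src /arc_dst /= => h.
by rewrite distE [dist i]di addeC EFinD leeD2l // -distE.
Qed.

Lemma upper_boundedS n i v : upper_bounded n.+1 i v -> upper_bounded n i v.
Proof. by move=> h p ip lt_p; apply: h ip _; apply: leqW. Qed.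

Variable e : R.
Hypothesis e_ge0 : 0 <= e.
Hypothesis e_le : forall i j, (i, j) \in E -> e <= w i j.

(** The cap at [dist i] lets correct values satisfy the bound for every [n]. *)
Definition lower_bounded (c : R) n i (v : \bar R) : Prop :=
  ((Num.min (dist i) (c + e *+ n))%:E <= v)%E.

Lemma lower_boundedS c n i v :
  lower_bounded c n.+1 i v -> lower_bounded c n i v.
Proof.
apply: le_trans; rewrite lee_fin le_min !ge_min lexx /=.
by rewrite lerD2l mulrSr lerDl e_ge0 orbT.
Qed.

(** When an edge weight is added to the minimum, the distance branch stays above [dist i] by
    [dist_edge] and the other branch gains at least [e]. *)
Lemma lower_bounded_update c n :
  update_sound E w S (lower_bounded c n) (lower_bounded c n.+1).
Proof.
move=> D i AD; rewrite /lower_bounded exec_update; case: ifPn => iS.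
  by rewrite lee_fin ge_min /dist dist_source ?lexx.
apply/bigmin_geP; split=> [|a /eqP ai]; first by rewrite leey.
have /= h := AD (c_buf a).
apply: le_trans (leeD2r _ h); rewrite -EFinD lee_fin ai.
have ia : (i, arc_dst a) \in E by rewrite -ai /arc_src /arc_dst -surjective_pairing (valP a).
have := dist_edge w_gt0 S_reachable ia; rewrite -/(dist i) -/(dist (arc_dst a)) => tri.
rewrite addr_minl le_min !ge_min addrC tri /= mulrSr addrA.
by rewrite lerD2l e_le // orbT.
Qed.

Variables (D0 : state (R := R) E) (Q : nat -> seq (instr E)).
Variables (PR PU PW : nat).
Variables (Rd : nat -> {set edge E}) (Up : nat -> {set V}) (Wr : nat -> {set edge E}).
Hypothesis Q_valid :
  forall t : nat, (1 <= t)%N -> valid_queue (Rd t) (Up t) (Wr t) (Q t).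
Hypothesis Q_async : bounded_asynchrony PR PU PW Rd Up Wr Q.
Local Notation D := (trajectory w S D0 Q).

Lemma DstarE (k : Defs.coord E) : Dstar w S k = dstar E w S (coord_node k).
Proof. by case: k => [[]|]. Qed.

(** [upper_bounded 0] is vacuous, so the chain starts from any [D0]; the effective diameter exceeds
    the [size] of every shortest path. *)
Lemma trajectory_upper t :
  ((PR + PU + PW) * effective_diameter E w S <= t)%N ->
  forall k, (D t k <= Dstar w S k)%E.
Proof.
move=> le_t k; rewrite DstarE.
have [p kp _] := shortest_path_exists w S_reachable (coord_node k).
have h0 : all_coords (upper_bounded 0) D0 by [].
apply: (all_coords_rounds Q_valid Q_async upper_boundedS upper_bounded_update
  le_t h0 k p kp).
exact: (shortest_path_size kp).
Qed.

(** [c] is a floor for the initial underestimates; [n] rounds raise it to at least every distance,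
    and only the cap remains. *)
Lemma trajectory_lower c n t :
  (forall k, (mine (Dstar w S k) c%:E <= D0 k)%E) ->
  (forall i, dist i <= c + e *+ n) ->
  ((PR + PU + PW) * n <= t)%N ->
  forall k, (Dstar w S k <= D t k)%E.
Proof.
move=> hD0 hc le_t k.
have h0 : all_coords (lower_bounded c 0) D0.
  move=> k'; apply: le_trans (hD0 k').
  by rewrite DstarE distE mulr0n addr0 EFin_min.
rewrite DstarE distE.
apply: le_trans (all_coords_rounds Q_valid Q_async (@lower_boundedS c)
  (@lower_bounded_update c) le_t h0 k).
by rewrite lee_fin le_min lexx hc.
Qed.

Lemma Dstar_errors (D : state (R := R) E) : D =1 Dstar w S ->
  [/\ Delta_plus w S D = 0%E, Delta_minus w S D = 0%E,
      L_max w S D = 0%E & L_plus w S D = 0%E].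
Proof.
move=> DE.
have Dfin (k : Defs.coord E) : (Dstar w S k - Dstar w S k = 0)%E.
  by rewrite DstarE distE -EFinB subrr.
have p0 : Delta_plus w S D = 0%E.
  by apply: big1_idem => [|k _]; [exact: maxxx|rewrite DE].
have m0 : Delta_minus w S D = 0%E.
  by apply: big1_idem => [|k _]; [exact: maxxx|rewrite DE].
by rewrite /L_max /L_plus p0 m0 maxxx adde0.
Qed.

End Convergence.

(** * Finiteness of the constants and the number of rounds *)

Theorem corollary3p7 (R : realType) (V : finType) (E : {set V * V})
    (w : V -> V -> R) (S : {set V})
    (hS : S \proper [set: V])
    (hw : forall i j : V, (i, j) \in E -> 0 < w i j)
    (A1 : reachable_source E S)
    (PR PU PW : nat)
    (Rd : nat -> {set edge E}) (Up : nat -> {set V}) (Wr : nat -> {set edge E})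
    (Q : nat -> seq (instr E))
    (hQ : forall t : nat, (1 <= t)%N -> valid_queue (Rd t) (Up t) (Wr t) (Q t))
    (A2 : bounded_asynchrony PR PU PW Rd Up Wr Q)
    (D0 : state (R := R) E) (hD0 : forall k, (-oo < D0 k)%E) :
  let D := trajectory w S D0 Q in
  forall t : nat, T_conv w S (PR + PU + PW) D0 <= t%:Z ->
    [/\ Delta_plus w S (D t) = 0%E, Delta_minus w S (D t) = 0%E,
        L_max w S (D t) = 0%E & L_plus w S (D t) = 0%E].
Proof.
move=> D t le_t; apply: Dstar_errors => // k.
have distE := dstarE w A1.
(* A node outside [S] has a nonempty path to [S], so an edge exists and [e_min] is not the default
   [+oo]. *)
have /properP[_ [i0 _ i0S]] := hS.
have [a0 _] : exists a : edge E, true.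
  have [[|j p] /and3P[/= ij _ lp]] := A1 i0; first by rewrite lp in i0S.
  by case/andP: ij => ij _; exists (exist _ (i0, j) ij).
have [e eE] : exists e, e_min E w = e%:E.
  have [a _ aE] := @eq_bigmin _ _ _ +oo%E a0 predT
    (fun a : edge E => (w (arc_src a) (arc_dst a))%:E) isT (fun _ _ => leey _).
  by eexists; exact: aE.
have e_le i j : (i, j) \in E -> e <= w i j.
  move=> ij; rewrite -lee_fin -eE.
  exact: (bigmin_le +oo%E (exist _ (i, j) ij : edge E)
    (fun a => (w (arc_src a) (arc_dst a))%:E)).
have e_gt0 : 0 < e.
  rewrite -lte_fin -eE; apply/bigmin_gtP; split=> [|a _]; first exact: ltry.
  by rewrite lte_fin hw // /arc_src /arc_dst -surjective_pairing (valP a).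
have [m mE] : exists m, dstar_max E w S = m%:E.
  have [i _ iE] := @eq_bigmax _ _ _ -oo%E i0 predT
    (fun i : V => dstar E w S i) isT (fun _ _ => leNye _).
  by exists (fine (dstar E w S i)); rewrite -distE; exact: iE.
have m_ge i : fine (dstar E w S i) <= m.
  by rewrite -lee_fin -distE -mE; apply: le_bigmax.
have le_plus : ((PR + PU + PW) * effective_diameter E w S <= t)%N.
  move: le_t; rewrite /T_conv /T_plus; case: ifP => _; rewrite ?ge_max.
    by case/andP.
  by [].
apply: le_anti; rewrite (trajectory_upper hw A1 D0 hQ A2 le_plus) /=.
(* Without initial underestimates zero rounds suffice, with the floor [m] above all distances. *)
have [S0|S0] := eqVneq (Sminus w S D0) set0.
  apply: (trajectory_lower hw A1 (ltW e_gt0) e_le (D0 := D0) hQ A2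
    (c := m) (n := 0)).
  - move=> k'; rewrite ge_min; apply/orP; left.
    by rewrite leNgt; have := in_set0 k'; rewrite -S0 inE => ->.
  - by move=> i; rewrite mulr0n addr0 m_ge.
  - by rewrite muln0.
have /set0Pn[k0 k0S] := S0.
(* The minimum is attained at an underestimated coordinate, hence below a finite distance; [hD0]
   excludes [-oo]. *)
have [c lt_cm cE] : exists2 c, c < m & D_min w S D0 = c%:E.
  have [k1 k1S k1E] := @eq_bigmin _ _ _ +oo%E k0 (mem (Sminus w S D0))
    (fun k => D0 k) k0S (fun _ _ => leey _).
  rewrite /D_min k1E; have : k1 \in Sminus w S D0 by [].
  rewrite inE DstarE distE; have := hD0 k1.
  case: (D0 k1) => // c _ lt_c; exists c => //.
  by rewrite lte_fin in lt_c; apply: lt_le_trans lt_c (m_ge _).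
move: le_t; rewrite /T_conv S0 ge_max => /andP[_].
rewrite /T_minus cE eE mE -EFinB /=.
set x := (m - c) / e; have x_ge0 : 0 <= x.
  by rewrite divr_ge0 ?ltW // subr_gt0.
(* A nonnegative ceiling is a natural number [n], the number of rounds. *)
have : 0 <= Num.ceil x by rewrite ceil_ge0 (lt_le_trans _ x_ge0) // ltrN10.
have := ceil_ge x; case: (Num.ceil x) => // n x_le _ le_n.
apply: (trajectory_lower hw A1 (ltW e_gt0) e_le (D0 := D0) hQ A2 (c := c) (n := n)).
(* An entry below its true value lies in [Sminus], so it is at least the minimum [c]. *)
- move=> k'; rewrite ge_min; have [//|lt_k'] := leP (Dstar w S k') (D0 k').
  by rewrite -cE; apply: bigmin_le_cond; rewrite inE.
- move=> i; apply: le_trans (m_ge i) _.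
  by rewrite -lerBlDl -mulr_natl -ler_pdivrMr.
- exact: le_n.
Qed.
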